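(* Let $m\ge 3$ and $n\ge 2$ be integers and let $\mathscr{A}\in\mathbb{T}_{m,n}$ be a nonnegative tensor (all entries $a_{i_1\cdots i_m}\ge 0$). Then the following four properties are equivalent: (1) $\mathscr{A}$ is an $R_0$-tensor; (2) $\mathscr{A}$ is an $R$-tensor; (3) $\mathscr{A}$ is a $Q$-tensor; (4) $\mathscr{A}$ is an $ER$-tensor.
   Context: $[n]=\{1,\ldots,n\}$, $\mathbb{R}^n_+=\{x\in\mathbb{R}^n:x\ge 0\}$ (componentwise), $\mathbb{R}_+=[0,\infty)$. $\mathbb{T}_{m,n}$ is the set of real $m$-order $n$-dimensional tensors $\mathscr{A}=(a_{i_1\cdots i_m})$, $a_{i_1\cdots i_m}\in\mathbb{R}$ for $i_1,\ldots,i_m\in[n]$ (no symmetry assumed). For $x\in\mathbb{R}^n$, $\mathscr{A}x^{m-1}\in\mathbb{R}^n$ is defined by $(\mathscr{A}x^{m-1})_i=\sum_{i_2,\ldots,i_m=1}^n a_{ii_2\cdots i_m}x_{i_2}\cdots x_{i_m}$. $R$-tensor: there is no $(x,t)\in(\mathbb{R}^n_+\setminus\{0\})\times\mathbb{R}_+$ such that for all $i\in[n]$: $(\mathscr{A}x^{m-1})_i+t=0$ if $x_i>0$, and $(\mathscr{A}x^{m-1})_i+t\ge 0$ if $x_i=0$. $R_0$-tensor: there is no $x\in\mathbb{R}^n_+\setminus\{0\}$ such that for all $i\in[n]$: $(\mathscr{A}x^{m-1})_i=0$ if $x_i>0$, and $(\mathscr{A}x^{m-1})_i\ge 0$ if $x_i=0$.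 $ER$-tensor: there is no $(x,t)\in(\mathbb{R}^n_+\setminus\{0\})\times\mathbb{R}_+$ such that for all $i\in[n]$: $(\mathscr{A}x^{m-1})_i+tx_i=0$ if $x_i>0$, and $(\mathscr{A}x^{m-1})_i\ge 0$ if $x_i=0$. $Q$-tensor: for every $q\in\mathbb{R}^n$ the tensor complementarity problem TCP$(q,\mathscr{A})$ has a solution, i.e. there is $x\in\mathbb{R}^n$ with $x\ge 0$, $\mathscr{A}x^{m-1}+q\ge 0$, $x^T(\mathscr{A}x^{m-1}+q)=0$. *)

(* Defs.v *)
From HB Require Import structures.
From mathcomp Require Import all_boot all_order all_algebra.
From mathcomp Require Import reals.

Set Implicit Arguments.
Unset Strict Implicit.
Unset Printing Implicit Defensive.

Import Order.TTheory GRing.Theory Num.Theory.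
Local Open Scope ring_scope.

(* The entry a_{i_1 ... i_m} is A [tuple i_1; ...; i_m]. *)
Definition tensor (R : realType) (m n : nat) : Type := {ffun m.-tuple 'I_n -> R}.

Definition nonneg_tensor (R : realType) (m n : nat) (A : tensor R m n) : Prop :=
  forall s : m.-tuple 'I_n, 0 <= A s.

Definition nonneg_vec (R : realType) (n : nat) (x : 'cV[R]_n) : Prop :=
  forall i, 0 <= x i 0.

(* (A x^{m-1})_i: the sum over (i_2, ..., i_m) is written as the sum over the
   tuples s = (i_1, ..., i_m) whose first index i_1 is i (for m >= 1). *)
Definition tensor_app (R : realType) (m n : nat) (A : tensor R m n)
    (x : 'cV[R]_n) : 'cV[R]_n :=
  \col_i \sum_(s : m.-tuple 'I_n | ohead s == Some i)
    A s * \prod_(j <- behead s) x j 0.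

Definition R_tensor (R : realType) (m n : nat) (A : tensor R m n) : Prop :=
  ~ exists (x : 'cV[R]_n) (t : R),
      [/\ nonneg_vec x, x != 0, 0 <= t &
        forall i, (0 < x i 0 -> tensor_app A x i 0 + t = 0) /\
                  (x i 0 = 0 -> 0 <= tensor_app A x i 0 + t)].

Definition R0_tensor (R : realType) (m n : nat) (A : tensor R m n) : Prop :=
  ~ exists x : 'cV[R]_n,
      [/\ nonneg_vec x, x != 0 &
        forall i, (0 < x i 0 -> tensor_app A x i 0 = 0) /\
                  (x i 0 = 0 -> 0 <= tensor_app A x i 0)].

Definition ER_tensor (R : realType) (m n : nat) (A : tensor R m n) : Prop :=
  ~ exists (x : 'cV[R]_n) (t : R),
      [/\ nonneg_vec x, x != 0, 0 <= t &
        forall i, (0 < x i 0 -> tensor_app A x i 0 + t * x i 0 = 0) /\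
                  (x i 0 = 0 -> 0 <= tensor_app A x i 0)].

Definition TCP_solution (R : realType) (m n : nat) (q : 'cV[R]_n)
    (A : tensor R m n) (x : 'cV[R]_n) : Prop :=
  [/\ nonneg_vec x, nonneg_vec (tensor_app A x + q) &
      x^T *m (tensor_app A x + q) = 0].

Definition Q_tensor (R : realType) (m n : nat) (A : tensor R m n) : Prop :=
  forall q : 'cV[R]_n, exists x : 'cV[R]_n, TCP_solution q A x.

(* Main.v *)
Require Import Defs.
From HB Require Import structures.
From mathcomp Require Import all_boot all_order all_algebra.
From mathcomp Require Import reals.
From mathcomp Require Import zify lra.

Set Implicit Arguments.
Unset Strict Implicit.
Unset Printing Implicit Defensive.

Import Order.TTheory GRing.Theory Num.Theory.

(** For a nonnegative tensor each of the four properties amounts to positivity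
    of the diagonal entries a_{i...i}.  The only deep implication is that a
    positive diagonal gives the Q-property, which needs a fixed-point argument.
    It rests on Scarf's combinatorial theorem: for a finite set with linear
    orders indexed by I, call (s, C) dominant if every point is, for some order
    in C, below all of s; then a colouring of the points by I admits a dominant
    pair with #|s| = #|C| whose colours are exactly C (a door/room parity
    argument).  Applied to the grid points of a simplex, ordered by their
    coordinates and coloured by the index of the least h_i, it gives in the limit
    a point x of the simplex such that h_i(x) is minimal whenever x_i > 0.  The
    tensor complementarity problem is the case of a large simplex with an
    additional slack coordinate. *)

(** * Scarf's theorem *)

Section Scarf.
Variables (X I : finType) (rk : I -> X -> nat).
Hypothesis rk_inj : forall i, injective (rk i).

Definition dominant (s : {set X}) (C : {set I}) : bool :=
  [forall y, exists i in C, forall x in s, rk i y <= rk i x].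

Lemma dominantP (s : {set X}) (C : {set I}) :
  reflect (forall y, exists2 i, i \in C & {in s, forall x, rk i y <= rk i x})
          (dominant s C).
Proof.
apply: (iffP forallP) => H y.
  have /existsP[i /andP[iC /forallP hi]] := H y.
  by exists i => // x xs; have := hi x; rewrite xs.
have [i iC hi] := H y; apply/existsP; exists i; rewrite iC /=.
by apply/forallP => x; apply/implyP => /hi.
Qed.

Lemma dominantS (s s' : {set X}) (C C' : {set I}) :
  s' \subset s -> C \subset C' -> dominant s C -> dominant s' C'.
Proof.
move=> /subsetP hs /subsetP hC /dominantP H; apply/dominantP => y.
have [i iC hi] := H y; exists i; first exact: hC.
by move=> x /hs; apply: hi.
Qed.

Lemma rk_argmin (s : {set X}) (i : I) : s != set0 ->
  exists2 z, z \in s & {in s, forall x, rk i z <= rk i x}.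
Proof.
case/set0Pn => x0 x0s; case: (arg_minnP (rk i) x0s) => z zs zmin.
by exists z => // x; apply: zmin.
Qed.

(** * The two rooms above a door *)

Section Door.
Variables (t : {set X}) (D : {set I}) (z : I -> X).
Hypothesis domD : dominant t D.
Hypotheses (zt : forall i, z i \in t)
  (zmin : forall i, {in t, forall x, rk i (z i) <= rk i x}).

Lemma min_eq i x : x \in t -> {in t, forall y, rk i x <= rk i y} -> x = z i.
Proof.
move=> xt hx; apply: (@rk_inj i); apply/eqP.
by rewrite eqn_leq hx ?zt // zmin.
Qed.

(** Dominance at a point of [t] itself yields an order in which that point is the least of [t]. *)
Lemma dominant_min_onto (C : {set I}) : dominant t C -> z @: C = t.
Proof.
move=> /dominantP H; apply/setP => x; apply/imsetP/idP => [[i _ ->]|xt] //.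
by have [i iC hi] := H x; exists i => //; apply: min_eq.
Qed.

(** These are the points witnessing the failure of [dominant t (D :\ a)]. *)
Definition between_min a : pred X :=
  [pred y | [forall k in D :\ a, rk k (z k) < rk k y]].

Lemma between_minP a y :
  reflect {in D :\ a, forall k, rk k (z k) < rk k y} (between_min a y).
Proof. exact: (iffP forall_inP). Qed.

Lemma between_min_below a y : between_min a y -> {in t, forall x, rk a y <= rk a x}.
Proof.
move=> /between_minP ya; have /dominantP/(_ y)[i iD hi] := domD.
have [<- //|ia] := eqVneq i a.
have := ya i; rewrite !inE ia iD => /(_ isT).
by rewrite ltnNge hi ?zt.
Qed.

Hypothesis cardD : #|D| = #|t|.+1.

(* Otherwise the minima of x |: t over D would take at most #|D| - 1 = #|t|
   values, while dominance makes every point of x |: t a minimum. *)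
Lemma dominant_add_uniq x a k : dominant (x |: t) D -> x \notin t ->
  a \in D -> k \in D -> {in t, forall y, rk a x <= rk a y} ->
  {in t, forall y, rk k x <= rk k y} -> a = k.
Proof.
move=> /dominantP H xt aD kD xa xk; apply/eqP; apply: contraT => ak.
have strict i w : {in t, forall y, rk i x <= rk i y} -> w \in t ->
    {in x |: t, forall y, rk i w <= rk i y} -> False.
  move=> xi wt wi; move: xt; suff -> : x = w by rewrite wt.
  by apply: (@rk_inj i); apply/eqP; rewrite eqn_leq xi ?wi ?setU11.
have sub : t \subset z @: (D :\ a :\ k).
  apply/subsetP => w wt; have [i iD wi] := H w.
  apply/imsetP; exists i; last first.
    by apply: min_eq => // y yt; apply: wi; rewrite inE yt orbT.
  rewrite !inE iD andbT; apply/andP; split; apply/eqP => E; subst i.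
    exact: (strict k w).
  exact: (strict a w).
have := leq_trans (subset_leq_card sub) (leq_imset_card _ _).
have kDa : k \in D :\ a by rewrite !inE eq_sym ak.
have := cardsD1 k (D :\ a); have := cardsD1 a D; rewrite aD kDa cardD !add1n.
by case=> -> ->; rewrite ltnn.
Qed.

(** The new point is least only for [a], so every other order of [D] keeps its minimum in [t].
    Dominance at the points of [t] then has to use these other minima, and dominance at a point of
    [between_min a] has to use [a]. *)
Lemma dominant_addP a x : a \in D -> x \notin t -> dominant (x |: t) D ->
  {in t, forall y, rk a x <= rk a y} ->
  [/\ z @: (D :\ a) = t, between_min a x &
      forall y, between_min a y -> rk a y <= rk a x].
Proof.
move=> aD xt dx xa; have /dominantP H := dx; split.
- apply/setP => w; apply/imsetP/idP => [[i _ ->]|wt] //.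
  have [i iD hi] := H w; exists i; last first.
    by apply: min_eq => // y yt; apply: hi; rewrite inE yt orbT.
  rewrite !inE iD andbT; apply/eqP => E; subst i.
  case/negP: xt; suff -> : x = w by [].
  by apply: (@rk_inj a); apply/eqP; rewrite eqn_leq xa ?hi ?setU11.
- apply/between_minP => k; rewrite !inE => /andP[ka kD].
  rewrite ltnNge; apply/negP => xk.
  case/eqP: ka; apply: (dominant_add_uniq dx) => // y yt.
  exact: leq_trans xk (zmin _ _).
- move=> y /between_minP ya; have [i iD hi] := H y.
  have [E|ia] := eqVneq i a; first by rewrite -E hi ?setU11.
  have := ya i; rewrite !inE ia iD => /(_ isT).
  by rewrite ltnNge hi // inE zt orbT.
Qed.

Definition added a : {set X} :=
  [set x | [&& x \notin t, dominant (x |: t) D & [forall y in t, rk a x <= rk a y]]].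

Lemma addedP a x : reflect [/\ x \notin t, dominant (x |: t) D &
  {in t, forall y, rk a x <= rk a y}] (x \in added a).
Proof.
rewrite inE; apply: (iffP and3P) => -[? ?].
  by move/forall_inP.
by move=> ?; split=> //; apply/forall_inP.
Qed.

(* Each redundant index a yields exactly one room above the door (t, D): either
   a can be dropped from D, or the a-greatest point beyond the other minima can
   be added to t. *)
Lemma rooms_at_index a : a \in D ->
  dominant t (D :\ a) + #|added a| = (z @: (D :\ a) == t).
Proof.
move=> aD.
have [dta|ndta] := boolP (dominant t (D :\ a)).
  rewrite (dominant_min_onto dta) eqxx (_ : added a = set0) ?cards0 //.
  apply/setP => x; rewrite in_set0; apply/negP => /addedP[xt dx xa].
  have [_ /between_minP bx _] := dominant_addP aD xt dx xa.
  have /dominantP/(_ x)[k kDa kx] := dta.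
  by have := bx k kDa; rewrite ltnNge kx ?zt.
rewrite add0n; have [E|nE] := eqVneq; last first.
  rewrite (_ : added a = set0) ?cards0 //.
  apply/setP => x; rewrite in_set0; apply/negP => /addedP[xt dx xa].
  by have [E _ _] := dominant_addP aD xt dx xa; rewrite E eqxx in nE.
(* Since [D :\ a] does not dominate, candidates for the new point exist; the [a]-greatest of them is
   taken. *)
have [y0 y0a] : exists y, between_min a y.
  case/forallPn: ndta => y hy; exists y; apply/between_minP => k kDa.
  rewrite ltnNge; apply/negP => yk; case/negP: hy.
  apply/existsP; exists k; rewrite kDa /=; apply/forall_inP => x xt.
  exact: leq_trans yk (zmin _ _).
case: (arg_maxnP (rk a) y0a) => x xa xmax0.
have xmax y : between_min a y -> rk a y <= rk a x := xmax0 y.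
have xt : x \notin t.
  apply/negP; rewrite -E => /imsetP[k kDa xk].
  by have /between_minP/(_ k kDa) := xa; rewrite xk ltnn.
have xad : x \in added a.
  apply/addedP; split=> //; last exact: between_min_below.
  apply/dominantP => y; have [ya|] := boolP (between_min a y).
    exists a => // w; rewrite !inE => /orP[/eqP->|]; first exact: xmax.
    exact: between_min_below.
  rewrite negb_forall => /existsP[k]; rewrite negb_imply -leqNgt.
  case/andP=> kDa yk; exists k; first by move: kDa; rewrite inE => /andP[].
  move=> w; rewrite !inE => /orP[/eqP->|wt].
    by apply: leq_trans yk (ltnW _); have /between_minP/(_ k kDa) := xa.
  exact: leq_trans yk (zmin _ _).
rewrite (_ : added a = [set x]) ?cards1 //; apply/setP => w; rewrite inE.
apply/idP/eqP => [/addedP[wt dw wa]|-> //].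
have [_ bw wmax] := dominant_addP aD wt dw wa.
by apply: (@rk_inj a); apply/eqP; rewrite eqn_leq wmax // xmax.
Qed.

Lemma two_redundant_indices : \sum_(a in D) (z @: (D :\ a) == t) = 2.
Proof.
have zD := dominant_min_onto domD.
have [a aD [b /andP[/= ba bD] zab]] :
    exists2 a, a \in D & exists2 b, b \in [predD1 D & a] & z a = z b.
  apply/dinjectivePn/dinjectiveP => /card_in_imset.
  by rewrite zD cardD => /n_Sn.
have bDa : b \in D :\ a by rewrite in_setD1 ba.
have redundant c d : c \in D -> d \in D :\ c -> z c = z d -> z @: (D :\ c) = t.
  move=> cD dDc zcd; rewrite -[in RHS]zD -[in RHS](setD1K cD) imsetU1 zcd.
  by apply/esym/setUidPr; rewrite sub1set imset_f.
rewrite (big_setD1 a) //= (big_setD1 b) //= (redundant a b) // (redundant b a) //.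
  rewrite eqxx big1 // => c; rewrite !inE => /and3P[cb ca cD].
  apply/eqP; rewrite eqb0; apply/eqP => E.
  have /imset_injP : #|z @: (D :\ c)| == #|D :\ c|.
    have := cardsD1 c D; rewrite cD cardD E add1n => -[->] //.
  move/(_ a b); rewrite !inE aD bD eq_sym ca eq_sym cb => /(_ isT isT zab).
  by move/eqP; rewrite eq_sym (negPf ba).
by rewrite in_setD1 eq_sym ba.
Qed.

End Door.

(** Summing [rooms_at_index] over [D] gives 2, and each point that can be added is counted at
    exactly one index. *)
Lemma rooms_above_door (t : {set X}) (D : {set I}) :
  t != set0 -> dominant t D -> #|D| = #|t|.+1 ->
  #|[set x | (x \notin t) && dominant (x |: t) D]|
  + #|[set a in D | dominant t (D :\ a)]| = 2.
Proof.
move=> t0 domD cardD.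
have [z zP] : exists z : {ffun I -> X},
    forall i, (z i \in t) && [forall x in t, rk i (z i) <= rk i x].
  have [x0 _] := set0Pn _ t0.
  exists [ffun i => odflt x0 [pick y | (y \in t) && [forall x in t, rk i y <= rk i x]]].
  move=> i; rewrite ffunE; case: pickP => //= noy.
  have [y yt /forall_inP ymin] := rk_argmin i t0.
  by have := noy y; rewrite yt ymin.
have zt i : z i \in t by have /andP[] := zP i.
have zmin i : {in t, forall x, rk i (z i) <= rk i x}.
  by have /andP[_ /forall_inP] := zP i.
rewrite -(two_redundant_indices domD zt zmin cardD).
under [RHS]eq_bigr => a aD do
  rewrite -(rooms_at_index domD zt zmin cardD aD).
rewrite big_split /= addnC; congr (_ + _).
  by rewrite -sum1_card big_mkcond /= [RHS]big_mkcond /=; apply: eq_bigr => a _;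
     rewrite inE; case: (a \in D) => //=; case: dominant.
under eq_bigr do rewrite -sum1_card big_mkcond /=.
rewrite exchange_big /= -sum1_card big_mkcond /=; apply: eq_bigr => x _.
rewrite inE; case: ifP => [/andP[xt dx]|nx]; last first.
  rewrite big1 // => a _; case: ifP => // /addedP[xt dx _].
  by rewrite xt dx in nx.
have /dominantP/(_ x)[a aD ax] := dx.
rewrite (big_setD1 a) //= big1 ?addn0.
  rewrite (_ : _ \in _ = true) //; apply/addedP; split=> // y yt.
  by apply: ax; rewrite inE yt orbT.
move=> b; rewrite in_setD1 => /andP[ba bD]; case: ifP => // /addedP[_ _ bx].
case/eqP: ba; apply: (dominant_add_uniq zt zmin cardD dx) => // y yt.
by apply: ax; rewrite inE yt orbT.
Qed.

(** The door with empty point set is the odd one out: only the [i0]-greatest point can be added, and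
    dropping [i0] leaves no order at all to dominate [x0]. *)
Lemma rooms_above_outer_door (i0 : I) (x0 : X) :
  #|[set x | (x \notin set0) && dominant (x |: set0) [set i0]]|
  + #|[set a in [set i0] | dominant set0 ([set i0] :\ a)]| = 1.
Proof.
have [x _ xmax0] := arg_maxnP (rk i0) (isT : xpredT x0).
have xmax y : rk i0 y <= rk i0 x := xmax0 y isT.
rewrite (_ : [set x | _] = [set x]).
  rewrite cards1 (_ : [set a in _ | _] = set0) ?cards0 //.
  apply/setP => a; rewrite !inE; apply/negP => /andP[/eqP -> /dominantP/(_ x0)].
  by case=> i; rewrite !inE andNb.
apply/setP => y; rewrite !inE setU0; apply/dominantP/eqP => [/(_ x)|-> w].
  case=> i; rewrite inE => /eqP-> /(_ y); rewrite inE eqxx => /(_ isT) xy.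
  by apply: (@rk_inj i0); apply/eqP; rewrite eqn_leq xmax.
exists i0; first by rewrite inE.
by move=> v; rewrite inE => /eqP ->; apply: xmax.
Qed.

(** * Colourings and the parity count *)

Variable c : X -> I.

(** The two sets count the doors below the room whose colours are all their indices but [i0]. A room
    with colours exactly [C] has one such door, any other room has none or two. *)
Lemma doors_below_room (i0 : I) (s : {set X}) (C : {set I}) : #|s| = #|C| ->
  odd (#|[set x in s | (i0 \in C) && (c @: (s :\ x) == C :\ i0)]|
       + #|[set j | [&& j \notin C, i0 \in j |: C & c @: s == (j |: C) :\ i0]]|)
  = (c @: s == C).
Proof.
move=> sC; have [i0C|i0C] := boolP (i0 \in C); last first.
  rewrite (_ : [set x in s | _] = set0) ?cards0 ?add0n; last first.
    by apply/setP => x; rewrite !inE andbF.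
  have [E|nE] := eqVneq (c @: s) C.
    rewrite (_ : finset _ = [set i0]) ?cards1 //; apply/setP => j.
    rewrite !inE (negPf i0C) orbF; apply/and3P/eqP => [[_ /eqP-> //]|->].
    by rewrite i0C E setU1K.
  rewrite (_ : finset _ = set0) ?cards0 //; apply/setP => j.
  rewrite !inE (negPf i0C) orbF; apply/and3P => -[_ /eqP <-].
  by rewrite setU1K // (negPf nE).
have jC j : j \notin C -> (j |: C) :\ i0 = j |: (C :\ i0).
  move=> jC; apply/setP => k; rewrite !inE; case: (eqVneq k i0) => //= ->.
  by rewrite orbF; apply/esym/negP => /eqP E; rewrite -E i0C in jC.
have [x0 /= /andP[x0s /eqP E0]|none] :=
    pickP (fun x => (x \in s) && (c @: (s :\ x) == C :\ i0)); last first.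
  (* With these colours [c] would be injective on [s], and removing the point of colour [k] would
     give a door. *)
  have key k : c @: s = k |: (C :\ i0) -> k \notin C :\ i0 -> False.
    move=> E kn; have : k \in c @: s by rewrite E setU11.
    case/imsetP => x xs kx.
    have inj : {in s &, injective c}.
      apply/imset_injP; rewrite E cardsU1 kn sC (cardsD1 i0 C) i0C //.
    have := none x; rewrite xs /= => /eqP; apply.
    apply/setP => j; apply/imsetP/idP => [[y]|jC'].
      rewrite in_setD1 => /andP[yx ys] ->.
      have : c y \in c @: s by rewrite imset_f.
      rewrite E in_setU1 kx => /orP[/eqP/inj|//] => /(_ ys xs) yx'.
      by rewrite yx' eqxx in yx.
    have : j \in c @: s by rewrite E in_setU1 jC' orbT.
    case/imsetP => y ys jy; exists y => //; rewrite in_setD1 ys andbT.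
    by apply/eqP => yx; rewrite kx -yx -jy jC' in kn.
  rewrite (_ : [set x in s | _] = set0) ?cards0; last first.
    by apply/setP => x; rewrite !inE; apply: none.
  rewrite (_ : finset _ = set0) ?cards0.
    symmetry; apply/eqP => E; apply: (key i0); rewrite ?setD11 //.
    by rewrite setD1K.
  apply/setP => j; rewrite !inE; apply/and3P => -[jnC _].
  rewrite jC // => /eqP /key; apply.
  by rewrite in_setD1 negb_and jnC orbT.
have inj0 : {in s :\ x0 &, injective c}.
  apply/imset_injP; rewrite E0; apply/eqP.
  by have := cardsD1 x0 s; rewrite sC x0s (cardsD1 i0 C) i0C => -[].
have Es : c @: s = c x0 |: (C :\ i0) by rewrite -E0 -imsetU1 setD1K.
have col y : y \in s -> y != x0 -> c y \in C :\ i0.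
  by move=> ys yx; rewrite -E0 imset_f // in_setD1 yx.
rewrite Es /=.
have [k0|kn0] := eqVneq (c x0) i0.
  rewrite k0 setD1K // eqxx.
  rewrite (_ : [set x in s | _] = [set x0]); last first.
    apply/setP => x; rewrite !inE; apply/andP/eqP => [[xs /eqP E]|->].
      apply/eqP; apply: contraT => xx0.
      have : c x0 \in c @: (s :\ x) by rewrite imset_f // in_setD1 eq_sym xx0.
      by rewrite E k0 setD11.
    by rewrite x0s E0 eqxx.
  rewrite (_ : finset _ = set0) ?cards0 ?cards1 //.
  apply/setP => j; rewrite !inE; apply/and3P => -[jnC _ /eqP E].
  by have := i0C; rewrite E setD11.
have nC : (c x0 |: C :\ i0 == C) = false.
  by apply/eqP => E; move: i0C; rewrite -E !inE eqxx eq_sym (negPf kn0).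
rewrite nC.
(* If the colour of [x0] is already used by another point [x1], either of the two can be removed. If
   it lies outside [C], one door removes [x0] and the other adds the index [c x0]. *)
have [kC|knC] := boolP (c x0 \in C).
  have : c x0 \in c @: (s :\ x0) by rewrite E0 in_setD1 kn0.
  case/imsetP => x1; rewrite in_setD1 => /andP[x10 x1s] c01.
  rewrite (_ : [set x in s | _] = [set x0; x1]); last first.
    apply/setP => x; rewrite !inE; apply/andP/orP => [[xs /eqP E]|].
      have [->|xx0] := eqVneq x x0; [by left | right].
      apply: contraT => xx1.
      have : c x \in c @: (s :\ x) by rewrite E col.
      case/imsetP => y; rewrite in_setD1 => /andP[yx ys] cxy.
      have [yx0|yx0] := eqVneq y x0.
        case/eqP: xx1; apply: inj0; rewrite ?in_setD1 ?xx0 ?x10 //.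
        by rewrite cxy yx0 c01.
      by case/eqP: yx; apply: inj0; rewrite ?in_setD1 ?xx0 ?yx0.
    case=> /eqP->; first by rewrite x0s E0 eqxx.
    rewrite x1s; split=> //; rewrite -E0; apply/eqP/setP => j.
    apply/imsetP/imsetP => -[y]; rewrite in_setD1 => /andP[yx ys] ->.
      have [yx0|yx0] := eqVneq y x0; last by exists y; rewrite ?in_setD1 ?yx0.
      by exists x1; rewrite ?in_setD1 ?x10 // yx0.
    have [yx1|yx1] := eqVneq y x1; last by exists y; rewrite ?in_setD1 ?yx1.
    by exists x0; rewrite ?in_setD1 ?(eq_sym x0) ?x10 // yx1.
  rewrite (_ : finset _ = set0) ?cards0 ?cards2 1?eq_sym ?x10 //.
  apply/setP => j; rewrite !inE; apply/and3P => -[jnC _ /eqP E].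
  have : j \in c x0 |: C :\ i0 by rewrite E jC // setU11.
  rewrite !inE (negPf jnC) andbF orbF => /eqP j0.
  by rewrite j0 kC in jnC.
rewrite (_ : [set x in s | _] = [set x0]); last first.
  apply/setP => x; rewrite !inE; apply/andP/eqP => [[xs /eqP E]|->].
    apply/eqP; apply: contraT => xx0.
    have : c x0 \in c @: (s :\ x) by rewrite imset_f // in_setD1 eq_sym xx0.
    by rewrite E in_setD1 (negPf knC) andbF.
  by rewrite x0s E0 eqxx.
rewrite (_ : finset _ = [set c x0]) ?cards1 //.
apply/setP => j; rewrite !inE i0C orbT /=; apply/andP/eqP => [[jnC]|->].
  rewrite jC // => /eqP E; have : j \in c x0 |: C :\ i0 by rewrite E setU11.
  by rewrite !inE (negPf jnC) andbF orbF => /eqP.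
by rewrite jC.
Qed.

(* A door is a dominant pair (t, D) with #|D| = #|t| + 1; the rooms above it are
   the dominant pairs (x |: t, D) and (t, D :\ a). *)
Definition near_rainbow_door (i0 : I) (p : {set X} * {set I}) : bool :=
  [&& i0 \in p.2, c @: p.1 == p.2 :\ i0, #|p.2| == #|p.1|.+1 & dominant p.1 p.2].

Definition room (r : {set X} * {set I}) : bool :=
  (#|r.1| == #|r.2|) && dominant r.1 r.2.

(** For a fixed [x], adding and removing [x] are inverse bijections between doors avoiding [x] and
    rooms containing it. *)
Lemma double_count_elements (i0 : I) :
  \sum_(p | near_rainbow_door i0 p)
    #|[set x | (x \notin p.1) && dominant (x |: p.1) p.2]|
  = \sum_(r | room r)
      #|[set x in r.1 | (i0 \in r.2) && (c @: (r.1 :\ x) == r.2 :\ i0)]|.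
Proof.
under eq_bigr do rewrite -sum1_card big_mkcond /=.
under [RHS]eq_bigr do rewrite -sum1_card big_mkcond /=.
rewrite exchange_big [RHS]exchange_big /=; apply: eq_bigr => x _.
rewrite -!big_mkcondr /=.
rewrite (reindex_onto (fun r => (r.1 :\ x, r.2)) (fun p => (x |: p.1, p.2))) /=.
  apply: eq_bigl => -[s C] /=; rewrite !inE /near_rainbow_door /room /= eqxx /=.
  rewrite xpair_eqE eqxx andbT.
  have [xs|xs] := boolP (x \in s); last first.
    rewrite andFb andbF; apply/andP => -[_ /eqP E].
    by move: xs; rewrite -E setU11.
  rewrite setD1K // eqxx andbT (cardsD1 x s) xs add1n (eq_sym #|C|).
  case: (dominant s C) / boolP => ds; last by rewrite !andbF.
  rewrite (dominantS (subD1set s x) (subxx C) ds) !andbT.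
  by rewrite andbA andbC.
by move=> [t D] /=; rewrite !inE => /and3P[_ xt _]; rewrite setU1K.
Qed.

Lemma double_count_indices (i0 : I) :
  \sum_(p | near_rainbow_door i0 p) #|[set a in p.2 | dominant p.1 (p.2 :\ a)]|
  = \sum_(r | room r)
      #|[set j | [&& j \notin r.2, i0 \in j |: r.2 & c @: r.1 == (j |: r.2) :\ i0]]|.
Proof.
under eq_bigr do rewrite -sum1_card big_mkcond /=.
under [RHS]eq_bigr do rewrite -sum1_card big_mkcond /=.
rewrite exchange_big [RHS]exchange_big /=; apply: eq_bigr => j _.
rewrite -!big_mkcondr /=.
rewrite (reindex_onto (fun r => (r.1, j |: r.2)) (fun p => (p.1, p.2 :\ j))) /=.
  apply: eq_bigl => -[s C] /=; rewrite !inE /near_rainbow_door /room /= eqxx /=.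
  rewrite xpair_eqE eqxx !inE /=.
  have [jC|jC] := boolP (j \in C).
    rewrite !andbF; apply/andP => -[_ /eqP E].
    by move: jC; rewrite -E setD11.
  rewrite setU1K // eqxx andbT cardsU1 jC add1n eqSS (eq_sym #|s|).
  case: (dominant s C) / boolP => ds; last by rewrite !andbF.
  rewrite (dominantS (subxx s) (subsetUr [set j] C) ds) !andbT /=.
  by rewrite andbA andbC.
by move=> [t D] /=; rewrite !inE => /and3P[_ xt _]; rewrite setD1K.
Qed.

(** Incidences between near-rainbow doors and rooms are counted twice. From the doors the count is
    odd, as the outer door contributes 1 and every other door 2; from the rooms it would be even if
    no room had colours exactly [C]. *)
Theorem rainbow_room (i0 : I) (x0 : X) :
  exists s C, [/\ dominant s C, #|s| = #|C| & c @: s = C].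
Proof.
pose above (p : {set X} * {set I}) :=
  #|[set x | (x \notin p.1) && dominant (x |: p.1) p.2]|
  + #|[set a in p.2 | dominant p.1 (p.2 :\ a)]|.
have count : odd (\sum_(p | near_rainbow_door i0 p) above p).
  rewrite (bigD1 (set0, [set i0])) /=; last first.
    rewrite /near_rainbow_door /= set11 imset0 setDv eqxx cards1 cards0 /=.
    apply/dominantP => y; exists i0; rewrite ?set11 // => x.
    by rewrite inE.
  rewrite [above _](rooms_above_outer_door i0 x0) oddD /=.
  rewrite -dvdn2; apply: dvdn_sum => -[t D] /andP[/and4P[/= iD ct /eqP tD dD] nt].
  (* A near-rainbow door with [t] empty has [D :\ i0] empty, so it is the outer door. *)
  rewrite /above /= rooms_above_door //; apply: contraNneq nt => t0; subst t.
  move: ct; rewrite imset0 => /eqP ct.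
  by rewrite -(setD1K iD) -ct setU0.
move: count; rewrite big_split /= double_count_elements double_count_indices -big_split /=.
have [[s C] /= /andP[/andP[/eqP sC dsC] /eqP csC] _|none] :=
  pickP (fun r => room r && (c @: r.1 == r.2)); first by exists s, C.
rewrite -[odd _]negbK => /negP[]; rewrite -dvdn2; apply: dvdn_sum => -[s C] r.
have /andP[/= /eqP sC _] := r.
rewrite dvdn2 doors_below_room //.
by have := none (s, C); rewrite r /= => ->.
Qed.
End Scarf.

(** * Complementarity on the simplex *)

Section Grid.
Variables k N : nat.

Definition grid_point := {g : {ffun 'I_k.+1 -> 'I_N.+1} | \sum_j (g j : nat) == N}.

(** Encodes the lexicographic order on coordinate [i] followed by the enumeration rank, so that ties
    are broken and the order is strict. *)
Definition grid_rank (i : 'I_k.+1) (g : grid_point) : nat :=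
  val g i * #|{: grid_point}| + enum_rank g.

Lemma grid_rank_lt i (g g' : grid_point) : (val g i : nat) < val g' i -> grid_rank i g < grid_rank i g'.
Proof.
move=> lt; rewrite /grid_rank (leq_trans (n := (val g i).+1 * #|{: grid_point}|)) //.
  by rewrite mulSn addnC ltn_add2r.
exact: leq_trans (leq_mul lt (leqnn _)) (leq_addr _ _).
Qed.

Lemma grid_rank_le i (g g' : grid_point) : grid_rank i g <= grid_rank i g' -> (val g i : nat) <= val g' i.
Proof. by apply: contraTT; rewrite -!ltnNge; apply: grid_rank_lt. Qed.

Lemma grid_rank_inj i : injective (grid_rank i).
Proof.
move=> g g' E; have e : (val g i : nat) = val g' i.
  by apply/eqP; rewrite eqn_leq !grid_rank_le ?E.
by move: E; rewrite /grid_rank e => /addnI/val_inj/enum_rank_inj.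
Qed.

Lemma grid_pointE (f : 'I_k.+1 -> nat) : \sum_j f j = N ->
  exists g : grid_point, forall j, (val g j : nat) = f j.
Proof.
move=> fN.
have fle j : f j <= N by rewrite -fN (bigD1 j) //= leq_addr.
pose G : {ffun 'I_k.+1 -> 'I_N.+1} := [ffun j => inord (f j)].
have gN : \sum_j (G j : nat) == N.
  by apply/eqP; rewrite -[RHS]fN; apply: eq_bigr => j _; rewrite ffunE inordK ?ltnS.
by exists (exist _ G gN) => j /=; rewrite ffunE inordK ?ltnS.
Qed.

(* A cell dominant for the coordinate orders has coordinates nearly filling up
   the total N, hence its points are within k of each other. *)
Lemma rainbow_grid_cell (c : grid_point -> 'I_k.+1) :
  exists g : grid_point, forall i, k < val g i ->
    exists2 g' : grid_point, c g' = i &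
      forall j, val g' j <= val g j + k /\ val g j <= val g' j + k.
Proof.
have [x0 _] : exists g : grid_point, forall j, (val g j : nat) = (j == ord0) * N.
  apply: grid_pointE; rewrite (bigD1 ord0) //= mul1n big1 ?addn0 // => j.
  by move/negPf->.
have [s [C [dom sC cs]]] := rainbow_room grid_rank_inj c ord0 x0.
have [i1 i1C _] := dominantP _ _ _ dom x0.
have s0 : s != set0 by rewrite -card_gt0 sC card_gt0; apply/set0Pn; exists i1.
have [m mP] : exists m : 'I_k.+1 -> grid_point, forall i, m i \in s /\
    {in s, forall x, grid_rank i (m i) <= grid_rank i x}.
  apply: (@fin_all_exists _ (fun=> grid_point) (fun i m => m \in s /\
    {in s, forall x, grid_rank i m <= grid_rank i x})) => i.
  by have [z zs zmin] := rk_argmin grid_rank i s0; exists z.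
pose mu i : nat := val (m i) i.
have mule i x : x \in s -> mu i <= val x i by move=> xs; apply/grid_rank_le/(mP i).2.
(* Otherwise some grid point exceeds [mu] in every coordinate of [C], against dominance; [f] builds
   it by putting the surplus on [i1]. *)
have sumC : N < \sum_(i in C) (mu i).+1.
  rewrite ltnNge; apply/negP => le.
  pose f j := if j \in C then (mu j).+1 + (j == i1) * (N - \sum_(i in C) (mu i).+1) else 0.
  have [y yE] : exists y : grid_point, forall j, (val y j : nat) = f j.
    apply: grid_pointE; rewrite -big_mkcond big_split /= [X in _ + X](bigD1 i1) //=.
    rewrite eqxx mul1n [X in _ + (_ + X)]big1 ?addn0 ?subnKC // => j.
    by case/andP=> _ /negPf->.
  have [i iC yi] := dominantP _ _ _ dom y.
  have := grid_rank_le (yi _ (mP i).1); rewrite yE /f iC -/(mu i).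
  by rewrite leqNgt addSn ltnS leq_addr.
have sumC' : N < \sum_(i in C) mu i + #|C|.
  by move: sumC; under eq_bigr do rewrite -addn1; rewrite big_split /= sum1_card.
have Ck : #|C| <= k.+1 by rewrite -[X in _ <= X]card_ord max_card.
have totalx x j : x \in s -> val x j + \sum_(i in C | i != j) mu i <= N.
  move=> xs; apply: leq_trans (eq_leq (eqP (valP x))).
  rewrite [X in _ <= X](bigD1 j) //= leq_add2l big_mkcondl /=.
  by apply: leq_sum => i _; case: ifP => // _; apply: mule.
(* The other coordinates of [x] use up at least their [mu]. The strict inequality in [sumC'] turns
   the bound [k.+1] on the size of [C] into [k]. *)
have upper x j : x \in s -> val x j <= (if j \in C then mu j else 0) + k.
  have arith a b S d : N < b + S + d -> a + S <= N -> d <= k.+1 -> a <= b + k.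
    by lia.
  move=> xs; have := totalx x j xs; case: ifP => jC tot.
    by apply: arith tot Ck; rewrite -(bigD1 (P := mem C) j).
  apply: arith (tot) Ck; rewrite add0n (eq_bigl (mem C)) //.
  by move=> i /=; case: eqP => [->|_]; rewrite ?jC // andbT.
have near x x' j : x \in s -> x' \in s -> val x j <= val x' j + k.
  move=> xs xs'; apply: leq_trans (upper x j xs) _; rewrite leq_add2r.
  by case: ifP => // _; apply: mule.
(* Any point of the cell serves: off [C] its coordinates are at most [k], so a larger one has its
   index in [C], which is the set of colours. *)
have [g gs] := set0Pn _ s0; exists g => i ki.
have : i \in c @: s.
  by rewrite cs; apply: contraLR ki => /negPf iC; have := upper g i gs; rewrite iC -leqNgt.
by case/imsetP => g' g's ->; exists g' => // j; split; apply: near.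
Qed.
End Grid.

From mathcomp Require Import boolp classical_sets topology normedtype.
Import numFieldNormedType.Exports.
Local Open Scope ring_scope.

(** * From grid points to the simplex by compactness *)

Section Simplex.
Variables (R : realType) (k : nat) (h : 'I_k.+1 -> 'rV[R]_k.+1 -> R).

(** The point [z] is the vertex of colour [i] in the rainbow cell of [p], for the grid of mesh
    1/N. *)
Lemma approx_complementary_simplex (N : nat) : (0 < N)%N ->
  exists p : 'rV[R]_k.+1, [/\ forall i, 0 <= p 0 i <= 1, \sum_i p 0 i = 1 &
    forall i, k%:R / N%:R < p 0 i ->
      exists2 z : 'rV[R]_k.+1, forall l, h i z <= h l z &
        forall j, `|p 0 j - z 0 j| <= k%:R / N%:R].
Proof.
move=> N0; have N0' : 0 < N%:R :> R by rewrite ltr0n.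
pose pt (g : grid_point k N) : 'rV[R]_k.+1 := \row_j ((val g j : nat)%:R / N%:R).
pose c (g : grid_point k N) : 'I_k.+1 := [arg min_(i < ord0) h i (pt g)]%O.
have cP g l : h (c g) (pt g) <= h l (pt g).
  by rewrite /c; case: Order.TotalTheory.arg_minP => // i _; apply.
have [g gP] := rainbow_grid_cell c; exists (pt g); split.
- move=> i; rewrite mxE divr_ge0 //= ler_pdivrMr // mul1r ler_nat -ltnS.
  exact: ltn_ord.
- under eq_bigr do rewrite mxE.
  by rewrite -mulr_suml -natr_sum (eqP (valP g)) divff // gt_eqF.
- move=> i; rewrite mxE ltr_pM2r ?invr_gt0 // ltr_nat => /gP[g' <- gg'].
  exists (pt g') => // j; rewrite !mxE -mulrBl normrM [`|_^-1|]ger0_norm ?invr_ge0 ?ler0n //.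
  rewrite ler_pM2r ?invr_gt0 // ler_norml.
  by have [] := gg' j; rewrite -!(ler_nat R) !natrD; lra.
Qed.

Lemma complementary_simplex : (forall i, continuous (h i)) ->
  exists p : 'rV[R]_k.+1, [/\ forall i, 0 <= p 0 i, \sum_i p 0 i = 1 &
    forall i, 0 < p 0 i -> forall l, h i p <= h l p].
Proof.
move=> hc.
have /choice[u uP] := fun N => approx_complementary_simplex (ltn0Sn N).
have cbox := @rV_compact R k.+1 (fun=> `[0, 1]%classic) (fun=> @segment_compact R 0 1).
have ubox : (u @ \oo)%classic [set v | forall i, `[0, 1]%classic (v ord0 i)]%classic.
  by exists 0%N => // N _ i /=; rewrite in_itv /=; have [] := uP N.
have [p [pbox pcl]] := cbox _ _ ubox.
exists p; split.
- by move=> i; have /= := pbox i; rewrite in_itv /= => /andP[].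
- pose S (v : 'rV[R]_k.+1) := \sum_i v 0 i.
  have Sc : continuous S.
    by apply: continuous_big => [|i _]; [exact: add_continuous | exact: coord_continuous].
  have cl : closed [set v | S v = 1]%classic.
    exact: ((continuous_closedP _).1 Sc _ (@closed_eq R 1)).
  apply: cl => V pV.
  have [] := pcl [set v | S v = 1]%classic V _ pV; first by exists 0%N => // N _; have [] := uP N.
  by move=> v [? ?]; exists v.
- move=> i pi l; rewrite leNgt; apply/negP => lt.
  have /nbhs_ballP[e /= e0 eP] : (\forall v \near p, 0 < h i v - h l v)%classic.
    have hil : (h i v - h l v @[v --> p] --> h i p - h l p)%classic.
      exact: cvgB (hc i p) (hc l p).
    by apply: cvgr_gt hil _ _; rewrite subr_gt0.
  (* Half of [p 0 i] keeps coordinate [i] of a nearby [u N] above the mesh bound; half of [e] leaves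
     room for the two moves from [p] to [u N] and from [u N] to [z]. *)
  pose d := Num.min e (p 0 i) / 2%:R.
  have d0 : 0 < d by rewrite divr_gt0 // lt_min e0.
  have de : d *+ 2 <= e by rewrite -mulr_natr divfK ?pnatr_eq0 // ge_min lexx.
  have dp : d *+ 2 <= p 0 i by rewrite -mulr_natr divfK ?pnatr_eq0 // ge_min lexx orbT.
  pose M := Num.bound (k%:R / d).
  have small N : (M <= N)%N -> k%:R / N.+1%:R < d.
    move=> MN; rewrite ltr_pdivrMr ?ltr0n // mulrC -ltr_pdivrMr //.
    apply: lt_le_trans (archi_boundP _) _; first by rewrite divr_ge0 // ltW.
    by rewrite ler_nat; apply: leq_trans MN _.
  have [] := pcl [set u N | N in [set N | M <= N]%N]%classic (ball p d).
  - by exists M => // N MN; exists N.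
  - exact: nbhsx_ballx.
  move=> _ [[N /= MN <-] [_ pu]]; have kd := small N MN.
  have [_ _ /(_ i)[]] := uP N.
    by apply: lt_trans kd _; have := pu 0 i; rewrite /ball /= ltr_distlC => /andP[]; lra.
  move=> z zmin uz; have := zmin l; apply/negP; rewrite -ltNge -subr_gt0.
  apply: eP; split=> // a j; rewrite (ord1 a) /ball /=.
  rewrite -(subrKA (u N 0 j)); apply: le_lt_trans (ler_normD _ _) _.
  apply: lt_le_trans de; rewrite mulr2n; apply: ltrD (pu 0 j) _.
  exact: le_lt_trans (uz j) kd.
Qed.
End Simplex.

(** * Nonnegative tensors *)

Section NonnegTensor.
Variables (R : realType) (m n : nat) (A : tensor R m.+1 n).

Definition tensor_diag (i : 'I_n) : R := A (nseq_tuple m.+1 i).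

(** Every non-constant tuple starting with [i] has a later index different from [i], where [x]
    vanishes. *)
Lemma tensor_app_single (x : 'cV[R]_n) (i : 'I_n) :
  (forall j, j != i -> x j 0 = 0) -> tensor_app A x i 0 = tensor_diag i * x i 0 ^+ m.
Proof.
move=> x0; rewrite mxE (bigD1 (nseq_tuple m.+1 i)) //= big_nseq iter_mulr_1.
rewrite big1 ?addr0 // => s /andP[hs ns].
suff [j js ji] : exists2 j, j \in behead s & j != i.
  by rewrite (big_rem j) //= x0 // mul0r mulr0.
apply/hasP; apply: contraNT ns => /hasPn alls; apply/eqP/val_inj => /=.
case: s hs alls => -[|a s] //= /eqP[]sz /eqP[->] alls.
congr (_ :: _); rewrite -sz; apply/all_pred1P/allP => j /alls.
by rewrite negbK.
Qed.

Lemma tensor_app_continuous (T : topologicalType) (f : T -> 'cV[R]_n) i :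
  (forall j, continuous (fun v => f v j 0)) ->
  continuous (fun v => tensor_app A (f v) i 0).
Proof.
move=> fc.
have -> : (fun v => tensor_app A (f v) i 0) = (fun v =>
    \sum_(s : m.+1.-tuple 'I_n | ohead s == Some i)
      A s * \prod_(j <- behead s) f v j 0).
  by apply: funext => v; rewrite mxE.
apply: continuous_big => [|s _ v]; first exact: add_continuous.
apply: cvgM; first exact: cvg_cst.
by apply: (continuous_big (P := xpredT)) => [|j _]; [exact: mul_continuous | exact: fc].
Qed.

Hypothesis hA : nonneg_tensor A.

Lemma tensor_app_ge_diag (x : 'cV[R]_n) i : nonneg_vec x ->
  tensor_diag i * x i 0 ^+ m <= tensor_app A x i 0.
Proof.
move=> x0; rewrite mxE (bigD1 (nseq_tuple m.+1 i)) //= big_nseq iter_mulr_1.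
by rewrite lerDl sumr_ge0 // => s _; rewrite mulr_ge0 // prodr_ge0.
Qed.

Lemma tensor_app_ge0 (x : 'cV[R]_n) i : nonneg_vec x -> 0 <= tensor_app A x i 0.
Proof.
by move=> x0; rewrite mxE sumr_ge0 // => s _; rewrite mulr_ge0 // prodr_ge0.
Qed.

Lemma tensor_app_gt0 (x : 'cV[R]_n) i : (forall i, 0 < tensor_diag i) ->
  nonneg_vec x -> 0 < x i 0 -> 0 < tensor_app A x i 0.
Proof.
move=> dA x0 xi; apply: lt_le_trans (tensor_app_ge_diag i x0).
by rewrite mulr_gt0 // exprn_gt0.
Qed.

Lemma nonneg_vec_pos_entry (x : 'cV[R]_n) : nonneg_vec x -> x != 0 ->
  exists i, 0 < x i 0.
Proof.
move=> x0; apply: contra_neqP => /forallNP xle; apply/matrixP => i j.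
rewrite (ord1 j) mxE; apply/eqP; rewrite eq_le x0 leNgt andbT.
exact/negP/xle.
Qed.

(** If the diagonal entry at [i] vanishes, the unit vector at [i] violates the R0 property. *)
Lemma R0_diag_gt0 : R0_tensor A -> forall i, 0 < tensor_diag i.
Proof.
move=> R0 i; rewrite lt_neqAle hA andbT; apply/eqP => d0; apply: R0.
have e0 : nonneg_vec (delta_mx i 0 : 'cV[R]_n) by move=> j; rewrite mxE ler0n.
exists (delta_mx i 0); split=> //.
  by apply/eqP => /matrixP/(_ i 0)/eqP; rewrite !mxE !eqxx oner_eq0.
move=> j; split=> [|_]; last exact: tensor_app_ge0.
rewrite mxE eqxx andbT; have [->|] := eqVneq j i => [_|]; last by rewrite ltxx.
rewrite tensor_app_single -?d0 ?mul0r // => l li.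
by rewrite mxE (negPf li).
Qed.

Lemma diag_gt0_R : (forall i, 0 < tensor_diag i) -> R_tensor A.
Proof.
move=> dA [x [t [x0 /(nonneg_vec_pos_entry x0)[i xi] t0 /(_ i)[/(_ xi)/eqP]]]].
by rewrite gt_eqF // ltr_pwDl // tensor_app_gt0.
Qed.

Lemma diag_gt0_ER : (forall i, 0 < tensor_diag i) -> ER_tensor A.
Proof.
move=> dA [x [t [x0 /(nonneg_vec_pos_entry x0)[i xi] t0 /(_ i)[/(_ xi)/eqP]]]].
by rewrite gt_eqF // ltr_pwDl ?tensor_app_gt0 // mulr_ge0.
Qed.

Lemma TCP_complementary q (x : 'cV[R]_n) : TCP_solution q A x ->
  forall i, x i 0 * (tensor_app A x i 0 + q i 0) = 0.
Proof.
case=> x0 y0 /matrixP/(_ 0 0); rewrite !mxE => /psumr_eq0P xy i.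
have := xy _ i isT; rewrite mxE [(_ + q) i 0]mxE; apply=> j _.
by rewrite mxE mulr_ge0.
Qed.

(* With q = -1 at i and 1 elsewhere, a solution is supported on i. *)
Lemma Q_diag_gt0 : Q_tensor A -> forall i, 0 < tensor_diag i.
Proof.
move=> Q i; rewrite lt_neqAle hA andbT; apply/eqP => d0.
have [x sol] := Q (\col_j if j == i then -1 else 1).
have comp := TCP_complementary sol; case: sol => x0 y0 _.
have xj j : j != i -> x j 0 = 0.
  move=> ji; have /eqP := comp j; rewrite [X in _ + X]mxE (negPf ji) mulf_eq0 => /orP[/eqP //|].
  by rewrite gt_eqF // ltr_wpDl // tensor_app_ge0.
by have := y0 i; rewrite mxE tensor_app_single // -d0 mul0r add0r mxE eqxx; lra.
Qed.

(* The slack coordinate ord0 has residual 0.  If it vanished at the simplex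
   solution, some coordinate of tail v would be at least rho, which makes its
   residual positive, hence larger than that of the slack. *)
Lemma diag_gt0_Q : (0 < m)%N -> (0 < n)%N -> (forall i, 0 < tensor_diag i) -> Q_tensor A.
Proof.
move=> m0 n0 dA q.
(* The sum makes the diagonal term outweigh [q] at [rho]; the summand 1 ensures that powers of
   numbers above [rho] do not decrease. *)
pose rho := 1 + \sum_i `|q i 0| / tensor_diag i.
have rho1 : 1 <= rho.
  by rewrite lerDl sumr_ge0 // => i _; rewrite divr_ge0 // ltW.
have rhoq i : 0 < tensor_diag i * rho + q i 0.
  have : `|q i 0| / tensor_diag i < rho.
    rewrite /rho (bigD1 i) //= addrCA ltrDl ltr_pwDl // sumr_ge0 // => j _.
    by rewrite divr_ge0 // ltW.
  rewrite ltr_pdivrMr // [rho * _]mulrC; have := ler_norm (- q i 0); rewrite normrN; lra.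
(* With zero slack some coordinate of [v] is at least 1/n, and the factor [n%:R * rho] brings it to
   at least [rho]. *)
pose tail (v : 'rV[R]_n.+1) : 'cV[R]_n := \col_i (n%:R * rho * v 0 (lift ord0 i)).
pose h (j : 'I_n.+1) (v : 'rV[R]_n.+1) : R :=
  if unlift ord0 j is Some i then tensor_app A (tail v) i 0 + q i 0 else 0.
have hc j : continuous (h j).
  rewrite /h; case: (unlift ord0 j) => [i v|]; last exact: cst_continuous.
  have tc : continuous (fun v => tensor_app A (tail v) i 0).
    apply: tensor_app_continuous => l w.
    have -> : (fun v => tail v l 0) = (fun v => n%:R * rho * v 0 (lift ord0 l)).
      by apply: funext => v'; rewrite mxE.
    exact: cvgM (cvg_cst _) (@coord_continuous _ _ _ _ _ w).
  exact: cvgD (tc v) (cvg_cst _).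
have [v [v0 v1 vmin]] := complementary_simplex hc.
have hl i : h (lift ord0 i) v = tensor_app A (tail v) i 0 + q i 0.
  by rewrite /h liftK.
have h0 : h ord0 v = 0 by rewrite /h unlift_none.
have nr : 0 < n%:R * rho by rewrite mulr_gt0 ?ltr0n //; lra.
have t0 : nonneg_vec (tail v) by move=> i; rewrite mxE mulr_ge0 // ltW.
have [vz|vz] := eqVneq (v 0 ord0) 0.
  have [i vi] : exists i, 1 <= n%:R * v 0 (lift ord0 i).
    apply: contrapT => /forallNP small.
    have : n%:R * \sum_i v 0 (lift ord0 i) < \sum_(i < n) (1 : R).
      rewrite mulr_sumr; apply: ltr_sum => [|i _]; last by rewrite ltNge; apply/negP.
      by apply/hasP; exists (Ordinal n0); rewrite ?mem_index_enum.
    move: v1; rewrite big_ord_recl vz add0r => ->.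
    by rewrite mulr1 sumr_const card_ord ltxx.
  have ti : rho <= tail v i 0.
    by rewrite mxE mulrAC ler_peMl // (le_trans _ rho1).
  have hi : 0 < h (lift ord0 i) v.
    rewrite hl; apply: lt_le_trans (rhoq i) _; rewrite lerD2r.
    apply: le_trans (tensor_app_ge_diag i t0); rewrite ler_pM2l //.
    apply: le_trans (ti) _; rewrite -[X in X <= _]expr1 ler_weXn2l //.
    exact: le_trans rho1 ti.
  have vi0 : 0 < v 0 (lift ord0 i).
    by rewrite -(pmulr_rgt0 _ (_ : 0 < n%:R)) ?ltr0n //; lra.
  by have := vmin _ vi0 ord0; rewrite h0 leNgt hi.
(* Positive slack makes its residual 0 the least one: all residuals are nonnegative, and those with
   a positive coordinate vanish. *)
have vpos : 0 < v 0 ord0 by rewrite lt_neqAle eq_sym vz v0.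
have y0 i : 0 <= tensor_app A (tail v) i 0 + q i 0.
  by rewrite -hl -h0 vmin.
exists (tail v); split=> //; first by move=> i; rewrite mxE.
apply/matrixP => a b; rewrite !mxE big1 // => i _; rewrite (ord1 a) (ord1 b).
rewrite mxE [(_ + q) i 0]mxE.
have [E|ti] := eqVneq (v 0 (lift ord0 i)) 0.
  by rewrite [tail v i 0]mxE E mulr0 mul0r.
have vi : 0 < v 0 (lift ord0 i) by rewrite lt_neqAle eq_sym ti v0.
suff -> : tensor_app A (tail v) i 0 + q i 0 = 0 by rewrite mulr0.
by apply/eqP; rewrite eq_le y0 andbT -hl -h0 vmin.
Qed.
End NonnegTensor.

Local Close Scope ring_scope.

Theorem theorem4p1 (R : realType) (m n : nat) (hm : (3 <= m)%N) (hn : (2 <= n)%N)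
    (A : tensor R m n) (hA : nonneg_tensor A) :
  [/\ R0_tensor A <-> R_tensor A,
      R_tensor A <-> Q_tensor A &
      Q_tensor A <-> ER_tensor A].
Proof.
case: m hm A hA => [//|m] hm A hA.
(* Here [m] is the order minus one, the degree of the polynomial map. *)
have m0 : (0 < m)%N by rewrite ltnS in hm; apply: leq_trans hm.
have R_R0 : R_tensor A -> R0_tensor A.
  move=> RA [x [x0 xn0 xP]]; apply: RA; exists x, 0%R; split=> // i.
  by rewrite GRing.addr0.
have ER_R0 : ER_tensor A -> R0_tensor A.
  move=> RA [x [x0 xn0 xP]]; apply: RA; exists x, 0%R; split=> // i.
  by rewrite GRing.mul0r GRing.addr0.
(* R and ER reduce to R0 by taking t = 0; R0 and Q give a positive diagonal, which gives back R, Q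
   and ER. *)
have R0d := R0_diag_gt0 hA.
have Qd := Q_diag_gt0 hA.
have dQ := diag_gt0_Q hA m0 (ltnW hn).
have dR := diag_gt0_R hA.
have dER := diag_gt0_ER hA.
by split; split; auto.
Qed.
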